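(* Let $G$ be a simple graph on $n$ vertices and let $c$ be a colouring of $E(G)$ using $n$ colours, such that each colour class has size at least $2$. Then $G$ contains a cycle of length at most $\lceil n/2 \rceil$ whose edges all receive distinct colours under $c$ (a rainbow cycle).
   Context: A subgraph $H$ of an edge-coloured graph $(G,c)$ is rainbow if no two edges of $H$ have the same colour. A colour class is the set of edges receiving a given colour. *)

(* Defs.v *)
From mathcomp Require Export all_boot.

Set Implicit Arguments.
Unset Strict Implicit.
Unset Printing Implicit Defensive.

Section RainbowCycles.

Variable T : finType.

(* A simple graph on the vertex set T is a symmetric, irreflexive relation; an
   edge is the two-element set of its endpoints. *)
Definition simple_graph (e : rel T) : Prop := symmetric e /\ irreflexive e.

Definition edges (e : rel T) : {set {set T}} :=
  [set [set p.1; p.2] | p : T * T & e p.1 p.2].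

(* A colouring of E(G) is given by a total function on {set T}; its values
   outside of [edges e] are never used. *)
Definition colour_class (e : rel T) (C : finType) (c : {set T} -> C) (k : C) :
  {set {set T}} := [set f in edges e | c f == k].

(* Closed sequence of at least three distinct vertices; its length is [size p]. *)
Definition graph_cycle (e : rel T) (p : seq T) : Prop :=
  ucycle e p /\ 3 <= size p.

Definition cycle_edges (p : seq T) : {set {set T}} :=
  [set [set x; next p x] | x in p].

Definition rainbow (C : finType) (c : {set T} -> C) (F : {set {set T}}) : Prop :=
  {in F &, injective c}.

End RainbowCycles.

(* Main.v *)
Require Import Defs.
From mathcomp Require Import all_boot.
From mathcomp Require Import zify.

Set Implicit Arguments.
Unset Strict Implicit.
Unset Printing Implicit Defensive.

(** The proof is by induction on [n], for multigraphs with exactly two non-parallel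
    edges of each colour.  Contracting a connected set [X] that loses only [#|X| - 1]
    colours yields a smaller instance; a rainbow cycle of the contraction lifts to one
    that is longer by at most the diameter of [X].  A colour survives a contraction
    unless it has an edge inside [X], or it is a _star_ [{wa, wb}] whose leaves
    [a], [b] both lie in [X].

    For odd [n] it suffices to contract one edge that is not the leaf pair of a star;
    there is one, since there are twice as many edges as colours.

    For even [n = 2h] one must lose two vertices for each unit of length.  Let
    [{uv, uy}] be a star such that [uv] is not a leaf pair.  If [y] has another edge
    [yy'] that is not a leaf pair, contracting [uv] and [yy'] gives a rainbow [u]-[v]
    walk through [y], which the edge [uy] shortcuts.  Otherwise all other edges at [y]
    are leaf pairs of stars centred at neighbours of [y], and following these stars
    backwards either reaches the triangle [uvy], which can be contracted, or closes up
    to a wheel with hub [y] and more than [h] spokes, which leaves too few vertices.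
    Hence both edges of every star are leaf pairs, and counting shows that there is no
    star at all.  Then contracting a vertex with four of its neighbours loses four
    vertices and lengthens cycles by at most two. *)

Lemma not_uniq_map_split (T1 T2 : eqType) (f : T1 -> T2) (s : seq T1) :
  ~~ uniq (map f s) ->
  exists s1 x s2 y s3, s = s1 ++ x :: s2 ++ y :: s3 /\ f x = f y.
Proof.
elim: s => //= x s IH; rewrite negb_and negbK => /orP[/mapP[y ys fxy]|/IH].
  by case/splitPr: ys => s2 s3; exists [::], x, s2, y, s3.
by case=> s1 [a [s2 [b [s3 [-> fab]]]]]; exists (x :: s1), a, s2, b, s3.
Qed.

(** * Rainbow closed walks in edge-coloured multigraphs *)

Section Walks.

Variables V C : finType.
Implicit Types (e : C -> bool -> V * V) (s : seq (C * bool * bool)).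

(* The edges of colour [k] are [e k true] and [e k false]; a triple [(k, b, r)] is the
   edge [e k b], traversed forwards if [r] and backwards otherwise. *)
Definition col (d : C * bool * bool) : C := d.1.1.
Definition src e (d : C * bool * bool) : V :=
  if d.2 then (e d.1.1 d.1.2).1 else (e d.1.1 d.1.2).2.
Definition tgt e (d : C * bool * bool) : V :=
  if d.2 then (e d.1.1 d.1.2).2 else (e d.1.1 d.1.2).1.

Fixpoint walk e (p : V) s (q : V) : bool :=
  if s is d :: s' then (src e d == p) && walk e (tgt e d) s' q else p == q.

(** A loop counts with length one, two parallel edges of different colours with length two.
    Contractions create both. *)
Definition rainbow_closed e s : Prop :=
  [/\ s != [::], uniq (map col s) & exists p, walk e p s p].

Lemma walk_cat e p s1 s2 q :
  walk e p (s1 ++ s2) q <-> exists2 r, walk e p s1 r & walk e r s2 q.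
Proof.
elim: s1 p => [|d s1 IH] p /=.
  by split=> [w|[r /eqP->]] //; exists p.
split=> [/andP[-> /IH[r w1 w2]]|[r /andP[-> w1] w2]]; first by exists r.
by apply/IH; exists r.
Qed.

Lemma walk_rcons e p s d q :
  walk e p s (src e d) -> tgt e d = q -> walk e p (rcons s d) q.
Proof.
by move=> w hq; rewrite -cats1; apply/walk_cat; exists (src e d); rewrite //= hq !eqxx.
Qed.

(** Between two visits to the same vertex lies a shorter rainbow closed walk. *)
Lemma rainbow_closed_uniq_src e s : rainbow_closed e s ->
  exists s', [/\ rainbow_closed e s', size s' <= size s, {subset s' <= s}
                & uniq (map (src e) s')].
Proof.
have [n] := ubnP (size s); elim: n s => // n IH s sn cs.
have [us|/not_uniq_map_split[s1 [a [s2 [b [s3 [Es ab]]]]]]] :=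
  boolP (uniq (map (src e) s)); first by exists s; split.
case: cs => _ uc [p wp]; move: (wp);
  rewrite {1}Es => /walk_cat[r _ /=/andP[_ /walk_cat[t w2 /=/andP[bt _]]]].
have sub : {subset a :: s2 <= s}.
  by move=> d; rewrite Es mem_cat !inE mem_cat => /orP[->|->]; rewrite !orbT.
have cs2 : rainbow_closed e (a :: s2).
  split=> //; last by exists (src e a); rewrite /= eqxx ab (eqP bt).
  move: uc; rewrite Es map_cat cat_uniq => /and3P[_ _].
  by rewrite -cat_cons map_cat cat_uniq => /and3P[].
have ss : size (a :: s2) < size s.
  by rewrite Es !size_cat /= size_cat /= !addnS; move: (size s1) (size s2) (size s3); lia.
have [|s' [cs' ss' sub' us']] := IH (a :: s2) _ cs2; first exact: leq_trans ss _.
exists s'; split=> // [|d /sub'/sub //]; exact: leq_trans ss' (ltnW ss).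
Qed.

Definition relabel (f : V -> V) e : C -> bool -> V * V :=
  fun k b => (f (e k b).1, f (e k b).2).

Lemma src_relabel f e d : src (relabel f e) d = f (src e d).
Proof. by rewrite /src /=; case: ifP. Qed.

Lemma tgt_relabel f e d : tgt (relabel f e) d = f (tgt e d).
Proof. by rewrite /tgt /=; case: ifP. Qed.

(** Contraction of [X] to a chosen [x0] in [X]. The vertex type is kept, so the other vertices of
    [X] stay behind as isolated ones. *)
Definition collapse (X : {set V}) (x0 x : V) : V := if x \in X then x0 else x.

Lemma collapse_in (X : {set V}) x0 x : x0 \in X -> (collapse X x0 x \in X) = (x \in X).
Proof. by rewrite /collapse => x0X; case: ifP. Qed.

Lemma collapse_out (X : {set V}) x0 x : x \notin X -> collapse X x0 x = x.
Proof. by rewrite /collapse => /negPf->. Qed.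

Lemma collapse_inj (X : {set V}) x0 x y : x0 \in X -> collapse X x0 x = collapse X x0 y ->
  x = y \/ x \in X /\ y \in X.
Proof.
move=> x0X; rewrite /collapse; case: ifP => xX; case: ifP => yX; auto.
  by move=> E; rewrite E yX in x0X.
by move=> E; rewrite -E xX in x0X.
Qed.

(** Outside [X] the contraction is injective, so each next edge, whose source avoids [X], starts
    exactly where the lift has arrived. *)
Lemma walk_uncollapse (X : {set V}) x0 e x s q : x0 \in X ->
  all (fun d => src e d \notin X) s ->
  walk (relabel (collapse X x0) e) (collapse X x0 x) s q ->
  exists2 q', collapse X x0 q' = q & walk e x s q'.
Proof.
move=> x0X; elim: s x => [|d s IH] x /=.
  by move=> _ /eqP<-; exists x.
case/andP=> dX sX; rewrite src_relabel tgt_relabel => /andP[/eqP tx w].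
have [E|[]] := collapse_inj x0X tx; last by rewrite (negPf dX).
by have [q' E' w'] := IH _ sX w; exists q'; rewrite // E eqxx.
Qed.

(** A closed walk with distinct sources leaves the contracted vertex at most once. Rotated to start
    there, its lift can fail to close only by ending at another vertex of [X]. *)
Lemma rainbow_closed_uncollapse (X : {set V}) x0 e s : x0 \in X ->
  rainbow_closed (relabel (collapse X x0) e) s ->
  exists s', [/\ s' != [::], uniq (map col s'), size s' <= size s, {subset s' <= s} &
    rainbow_closed e s' \/
    exists p q, [/\ p \in X, q \in X, p != q & walk e p s' q]].
Proof.
move=> x0X /rainbow_closed_uniq_src[t [[t0 ut [p w]] st sub utl]].
have step d t' r : walk (relabel (collapse X x0) e) r (d :: t') r ->
    all (fun d => src e d \notin X) t' ->
    exists2 q, collapse X x0 q = collapse X x0 (src e d) & walk e (src e d) (d :: t') q.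
  rewrite /= tgt_relabel src_relabel => /andP[/eqP-> w'] a'.
  by have [q Eq wq] := walk_uncollapse x0X a' w'; exists q; rewrite ?eqxx.
have [/hasP[d dt dX]|nX] := boolP (has (fun d => src e d \in X) t).
  have [t1 [t2 Et]] : exists t1 t2, t = t1 ++ d :: t2.
    by case/splitPr: dt => t1 t2; exists t1, t2.
  have pt : perm_eq (d :: t2 ++ t1) t by rewrite Et -cat_cons perm_catC.
  have [r w1 w2] : exists2 r, walk (relabel (collapse X x0) e) p t1 r &
      walk (relabel (collapse X x0) e) r (d :: t2) p by apply/walk_cat; rewrite -Et.
  have w' : walk (relabel (collapse X x0) e) r (d :: t2 ++ t1) r.
    by rewrite -cat_cons; apply/walk_cat; exists p.
  have u' : uniq (map (src (relabel (collapse X x0) e)) (d :: t2 ++ t1)).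
    by rewrite (perm_uniq (perm_map _ pt)).
  have [|q Eq wq] := step _ _ _ w'.
    apply/allP=> d' d't; apply/negP=> d'X; move: u' => /=/andP[/negP[]].
    apply/mapP; exists d' => //; rewrite !src_relabel /collapse dX.
    by rewrite d'X.
  have qX : q \in X by rewrite -(collapse_in q x0X) Eq collapse_in.
  exists (d :: t2 ++ t1); split=> //.
  - by rewrite (perm_uniq (perm_map _ pt)).
  - by rewrite (perm_size pt).
  - by move=> d'; rewrite (perm_mem pt); apply: sub.
  have [E|N] := eqVneq (src e d) q; last by right; exists (src e d), q; split.
  left; split=> //; last by exists (src e d); rewrite {2}E.
  by rewrite (perm_uniq (perm_map _ pt)).
exists t; split=> //; left; split=> //; move: nX.
rewrite -all_predC; case: t t0 w {ut st sub utl} => // d t _ w /=/andP[dX aX].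
have [q Eq wq] := step _ _ _ w aX.
have Eq' : q = src e d by case: (collapse_inj x0X Eq) => // -[_]; rewrite (negPf dX).
by exists (src e d); rewrite Eq' in wq.
Qed.


Lemma rainbow_closed_cat e p s q t : s != [::] -> walk e p s q -> walk e q t p ->
  uniq (map col s) -> uniq (map col t) ->
  (forall d d', d \in s -> d' \in t -> col d != col d') ->
  rainbow_closed e (s ++ t).
Proof.
move=> s0 ws wt us ut dis; split; first by case: s s0 {ws us dis}.
  rewrite map_cat cat_uniq us ut andbT /=; apply/hasPn=> k /mapP[d' d't ->].
  by apply/negP=> /mapP[d ds E]; move: (dis _ _ ds d't); rewrite E eqxx.
by exists p; apply/walk_cat; exists q.
Qed.

(** If the lift opens up in [X], its ends are joined by a rainbow walk in the colours of [K], which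
    [s] avoids. *)
Lemma rainbow_closed_collapse_bound (X : {set V}) x0 (K : {set C}) e D s : x0 \in X ->
  (forall p q, p \in X -> q \in X -> p != q ->
     exists t, [/\ walk e p t q, uniq (map col t), size t <= D &
                   forall d, d \in t -> col d \in K]) ->
  rainbow_closed (relabel (collapse X x0) e) s ->
  (forall d, d \in s -> col d \notin K) ->
  exists s', [/\ rainbow_closed e s', size s' <= size s + D &
    forall d, d \in s' -> (d \in s) || (col d \in K)].
Proof.
move=> x0X conn cs sK.
have [s' [s0 us' ss' sub [cs'|[p [q [pX qX pq w]]]]]] := rainbow_closed_uncollapse x0X cs.
  by exists s'; split=> // [|d /sub-> //]; apply: leq_trans ss' (leq_addr _ _).
have [|t [wt ut st tK]] := conn _ _ qX pX; first by rewrite eq_sym.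
exists (s' ++ t); split.
- apply: rainbow_closed_cat w wt us' ut _ => // d d' ds d't.
  by apply: contraNneq (sK _ (sub _ ds)) => ->; apply: tK.
- by rewrite size_cat leq_add.
by move=> d; rewrite mem_cat => /orP[/sub->|/tK->]; rewrite ?orbT.
Qed.

(** * Parallel edges and stars *)

Definition parallel (p q : V * V) : bool := (p == q) || (p == (q.2, q.1)).

Lemma parallelP p q r t :
  reflect ((p = r /\ q = t) \/ (p = t /\ q = r)) (parallel (p, q) (r, t)).
Proof.
apply: (iffP orP) => -[] /=.
- by move/eqP=> [-> ->]; left.
- by move/eqP=> [-> ->]; right.
- by case=> -> ->; left.
by case=> -> ->; right.
Qed.

Definition adj e k x y : bool := [exists b, parallel (e k b) (x, y)].

Lemma adj_edge e k b : adj e k (e k b).1 (e k b).2.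
Proof. by apply/existsP; exists b; case: (e k b) => x y; apply/parallelP; left. Qed.

Lemma adj_sym e k x y : adj e k x y = adj e k y x.
Proof.
by apply: eq_existsb => b; case: (e k b) => p q; apply/parallelP/parallelP => -[]; auto.
Qed.

Lemma adj_walk e k x y : adj e k x y -> exists2 d, col d = k & walk e x [:: d] y.
Proof.
case/existsP=> b; case E: (e k b) => [p q] /parallelP[][Ep Eq].
  by exists (k, b, true) => //=; rewrite /src /tgt /= E Ep Eq !eqxx.
by exists (k, b, false) => //=; rewrite /src /tgt /= E Ep Eq !eqxx.
Qed.

Lemma adj_dart e d : adj e (col d) (src e d) (tgt e d).
Proof.
case: d => [[k b] r]; rewrite /src /tgt /col /=.
by case: r; rewrite ?[adj e k (e k b).2 _]adj_sym adj_edge.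
Qed.

Lemma adj_relabel f e k a b : adj (relabel f e) k a b ->
  exists x y, [/\ adj e k x y, f x = a & f y = b].
Proof.
case/existsP=> i; rewrite /relabel => /parallelP[][<- <-].
  by exists (e k i).1, (e k i).2; rewrite adj_edge.
by exists (e k i).2, (e k i).1; rewrite adj_sym adj_edge.
Qed.

Lemma adj_three e k x1 y1 x2 y2 x3 y3 :
  adj e k x1 y1 -> adj e k x2 y2 -> adj e k x3 y3 ->
  [\/ parallel (x1, y1) (x2, y2), parallel (x1, y1) (x3, y3)
    | parallel (x2, y2) (x3, y3)].
Proof.
have par p q r : parallel r p -> parallel r q -> parallel p q.
  case: p q r => [p1 p2] [q1 q2] [r1 r2] /parallelP pr /parallelP qr.
  by apply/parallelP; case: pr qr => [] [-> ->] [] [-> ->]; auto.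
case/existsP=> b1 P1 /existsP[b2 P2] /existsP[b3 P3].
have [E|] := eqVneq b1 b2; first by rewrite E in P1; constructor 1; apply: par P1 P2.
have [E _|] := eqVneq b1 b3; first by rewrite E in P1; constructor 2; apply: par P1 P3.
move=> n13 n12; have E : b2 = b3 by case: b1 b2 b3 n12 n13 {P1 P2 P3} => [] [] [].
by rewrite E in P2; constructor 3; apply: par P2 P3.
Qed.

Lemma adj_two e k w a b x y : adj e k w a -> adj e k w b -> a != b ->
  adj e k x y -> parallel (x, y) (w, a) || parallel (x, y) (w, b).
Proof.
move=> wa wb ab xy; case: (adj_three wa wb xy) => /parallelP[][E1 E2].
- by rewrite E2 eqxx in ab.
- by rewrite E2 E1 eqxx in ab.
- by apply/orP; left; apply/parallelP; left.
- by apply/orP; left; apply/parallelP; right.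
- by apply/orP; right; apply/parallelP; left.
- by apply/orP; right; apply/parallelP; right.
Qed.

(** The only edges of the colour are [wa] and [wb], and [w] is their only common vertex. *)
Lemma star_leaves e k w a b w' a' b' :
  adj e k w a -> adj e k w b -> a != b -> w != a -> w != b ->
  adj e k w' a' -> adj e k w' b' -> a' != b' ->
  w' = w /\ parallel (a', b') (a, b).
Proof.
move=> wa wb ab na nb wa' wb' ab'.
have [nab nba] : a <> b /\ b <> a by split; apply/eqP; rewrite // eq_sym.
have [nab' nwa nwb] : [/\ a' <> b', w <> a & w <> b] by split; apply/eqP.
have:= adj_two wa wb ab wa'; have:= adj_two wa wb ab wb'.
by move=> /orP[]/parallelP[][E1 E2] /orP[]/parallelP[][E3 E4]; split;
  try (apply/parallelP); intuition congruence.
Qed.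

(** Matched ends of the two edges are equal or both in [X]. Two pairs in [X] give an edge inside
    [X]; one common end is the centre of a star, or gives an inner edge if it lies in [X]. *)
Lemma collapse_parallel (X : {set V}) x0 e k : x0 \in X ->
  ~~ parallel (e k true) (e k false) ->
  parallel (relabel (collapse X x0) e k true) (relabel (collapse X x0) e k false) ->
  (exists a b, [/\ a \in X, b \in X & adj e k a b]) \/
  (exists w a b, [/\ w \notin X, a \in X, b \in X & [/\ a != b, adj e k w a & adj e k w b]]).
Proof.
move=> x0X; have at_ := adj_edge e k true; have af := adj_edge e k false.
move: at_ af; rewrite /relabel; case: (e k true) (e k false) => [a b] [c d] /= ab cd np.
wlog: c d cd np / collapse X x0 a = collapse X x0 c /\ collapse X x0 b = collapse X x0 d.
  move=> H /parallelP[][Ea Eb]; first by apply: (H c d) => //; apply/parallelP; left.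
  apply: (H d c); rewrite 1?adj_sym //; last by apply/parallelP; left.
  by apply: contra np => /parallelP[][-> ->]; apply/parallelP; auto.
case=> /(collapse_inj x0X)[Ea|[aX cX]] /(collapse_inj x0X)[Eb|[bX dX]] _; subst.
- by case/negP: np; apply/parallelP; left.
- have [cX|cX] := boolP (c \in X); first by left; exists c, b; split.
  right; exists c, b, d; split=> //; split=> //.
  by apply: contraNneq np => ->; apply/parallelP; left.
- have [dX|dX] := boolP (d \in X); first by left; exists a, d; split.
  right; exists d, a, c; split=> //; rewrite ![adj e k d _]adj_sym; split=> //.
  by apply: contraNneq np => ->; apply/parallelP; left.
by left; exists a, b; split.
Qed.
End Walks.

(** * Counting colours against vertices *)

Section Pigeonhole.

Variables V C : finType.
Implicit Types (e : C -> bool -> V * V) (S X : {set V}) (A : {set C}).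

Lemma edge_connects e k a b x0 x1 : adj e k a b -> x0 \in [set a; b] -> x1 \in [set a; b] ->
  x0 != x1 -> exists t, [/\ walk e x0 t x1, uniq (map (@col C) t), size t <= 1 &
                   forall d, d \in t -> col d \in [set k]].
Proof.
move=> ab; have ba : adj e k b a by rewrite adj_sym.
have [d dk wd] := adj_walk ab; have [d' d'k wd'] := adj_walk ba.
rewrite !inE => /orP[/eqP->|/eqP->] /orP[/eqP->|/eqP->]; rewrite ?eqxx // => _.
  by exists [:: d]; split=> // x; rewrite mem_seq1 => /eqP->; rewrite dk inE.
by exists [:: d']; split=> // x; rewrite mem_seq1 => /eqP->; rewrite d'k inE.
Qed.

Lemma collapse2_in S a b x : x \in S -> b \in S -> a != b ->
  collapse [set a; b] b x \in S :\ a.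
Proof.
move=> xS bS ab; rewrite /collapse !inE; case: (eqVneq x a) => [->|xa] /=.
  by rewrite eq_sym ab bS.
by case: (eqVneq x b) => [xb|_]; rewrite ?xa // eq_sym ab bS.
Qed.

Lemma rainbow_closed1 e k x : adj e k x x -> exists2 d, rainbow_closed e [:: d] & col d = k.
Proof. by case/adj_walk=> d dk w; exists d => //; split=> //; exists x. Qed.

(** Contracting one selected edge removes one vertex and one colour, and the lift is longer by at
    most one. *)
Lemma pigeonhole_rainbow_closed e S A (sel : C -> bool) :
  0 < #|S| <= #|A| ->
  (forall k, k \in A -> (e k (sel k)).1 \in S /\ (e k (sel k)).2 \in S) ->
  exists s, [/\ rainbow_closed e s, size s <= #|S| & forall d, d \in s -> col d \in A].
Proof.
have [n] := ubnP #|S|; elim: n e S A => // n IH e S A Sn /andP[S0 SA] ends.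
have [k kA] : exists k, k \in A by apply/card_gt0P; apply: leq_trans SA.
have [aS bS] := ends k kA; have ab := adj_edge e k (sel k).
move: aS bS ab; set a := _.1; set b := _.2 => aS bS ab.
have [Eab|nab] := eqVneq a b.
  have [|d cd dk] := @rainbow_closed1 e k b; first by rewrite -{1}Eab.
  by exists [:: d]; split=> // x; rewrite inE => /eqP->; rewrite dk.
have := cardsD1 a S; have := cardsD1 k A; rewrite aS kA => cA cS.
have S' : 0 < #|S :\ a|.
  by apply/card_gt0P; exists b; rewrite !inE eq_sym nab.
have [|||s [cs ss sA]] := IH (relabel (collapse [set a; b] b) e) (S :\ a) (A :\ k).
- by lia.
- by lia.
- by move=> j; rewrite in_setD1 => /andP[_ /ends[p q]]; split; apply: collapse2_in.
have [||||s' [cs' ss' s'A]] := @rainbow_closed_collapse_bound _ _ [set a;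
  b] b [set k] e 1 s.
- by rewrite !inE eqxx orbT.
- by move=> p q pX qX pq; apply: edge_connects ab _ _ pq.
- exact: cs.
- by move=> d /sA; rewrite !inE => /andP[].
exists s'; split=> //; first by lia.
by move=> d /s'A/orP[/sA/setD1P[]|/set1P->].
Qed.

(** Edges of colours other than [j] are contracted as long as the edges of [j] do not become
    parallel. When this gets stuck, there is a loop or a pair of parallel edges of different
    colours. *)
Lemma pigeonhole_rainbow_closed_proper e S A j :
  #|S| <= #|A| ->
  (forall k b, k \in A -> (e k b).1 \in S /\ (e k b).2 \in S) ->
  j \in A -> ~~ parallel (e j true) (e j false) ->
  exists s, [/\ rainbow_closed e s, size s < #|S| & forall d, d \in s -> col d \in A].
Proof.
have [n] := ubnP #|S|; elim: n e S A => // n IH e S A Sn SA ends jA np.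
have endsA k x y : k \in A -> adj e k x y -> x \in S /\ y \in S.
  move=> kA /existsP[b]; case: (ends k b kA); case: (e k b) => p q /= pS qS.
  by case/parallelP=> [][<- <-].
have S2 : 1 < #|S|.
  have [p q] := ends j true jA; have [p' q'] := ends j false jA.
  rewrite ltnNge; apply: contra np => /card_le1_eqP eqS.
  by move: p q p' q'; case: (e j true) (e j false) => a b [c d] /= p q p' q';
    apply/parallelP; left; rewrite (eqS _ _ p p') (eqS _ _ q q').
have [/exists_inP[k kA /existsP[x kx]]|noloop] :=
    boolP [exists k in A, [exists x, adj e k x x]].
  have [d cd dk] := rainbow_closed1 kx.
  by exists [:: d]; split=> // y; rewrite inE => /eqP->; rewrite dk.
have nl k x y : k \in A -> adj e k x y -> x != y.
  move=> kA xy; apply: contraNneq noloop => E.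
  by apply/exists_inP; exists k => //; apply/existsP; exists y; rewrite -{1}E.
(* On two vertices without loops the edges of [j] would be parallel. From here on a closed walk of
   length two is short enough. *)
have S3 : 2 < #|S|.
  rewrite ltnNge; apply/negP=> S2'; have cS : #|S| = 2 by lia.
  have /cards2P[x [y [xy ES]]] := introT eqP cS.
  case/negP: np; have := nl _ _ _ jA (adj_edge e j true); have :=
    nl _ _ _ jA (adj_edge e j false).
  have [p q] := ends j true jA; have [p' q'] := ends j false jA.
  move: p q p' q'; rewrite ES; case: (e j true) (e j false) => a b [c d] /=.
  by rewrite !inE => /pred2P[]-> /pred2P[]-> /pred2P[]-> /pred2P[]->;
    rewrite ?eqxx // => _ _; apply/parallelP; auto.
have digon i k x y : i \in A -> k \in A -> i != k -> adj e i x y -> adj e k x y ->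
    exists s, [/\ rainbow_closed e s, size s < #|S| & forall d, d \in s -> col d \in A].
  rewrite [adj e k _ _]adj_sym => iA kA ik /adj_walk[d di wd] /adj_walk[d' d'k wd'].
  exists ([:: d] ++ [:: d']); split=> //.
    apply: rainbow_closed_cat wd wd' _ _ _ => // x1 x2.
    by rewrite !inE => /eqP-> /eqP->; rewrite di d'k.
  by move=> x1; rewrite !inE => /orP[]/eqP->; rewrite ?di ?d'k.
(* Contracting an edge of [k] succeeds unless that edge is the leaf pair of a star of colour [j]. *)
have step k : k \in A -> k != j ->
   (exists s, [/\ rainbow_closed e s, size s < #|S| & forall d, d \in s -> col d \in A]) \/
   (exists w, [/\ (e k true).1 != (e k true).2,
      adj e j w (e k true).1 & adj e j w (e k true).2]).
  move=> kA kj; have ab := adj_edge e k true; have [aS bS] := ends k true kA.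
  have := nl _ _ _ kA ab.
  move: aS bS ab; set a := _.1; set b := _.2 => aS bS ab nab.
  have bX : b \in [set a; b] by rewrite !inE eqxx orbT.
  have [pp|np'] := boolP (parallel (relabel (collapse [set a; b] b) e j true)
                         (relabel (collapse [set a; b] b) e j false)).
    have [[x [y [xX yX xy]]]|[w [x [y [wX xX yX [nxy wx wy]]]]]] :=
      collapse_parallel bX np pp.
      left; apply: (@digon j k a b) => //; first by rewrite eq_sym.
      have := nl _ _ _ jA xy; move: xX yX xy; rewrite !inE => /pred2P[]-> /pred2P[]->;
        by rewrite ?eqxx // adj_sym.
    right; exists w; split=> //; move: xX yX nxy wx wy;
      rewrite !inE => /pred2P[]-> /pred2P[]->;
      by rewrite ?eqxx.
  left; have := cardsD1 a S; have := cardsD1 k A; rewrite aS kA => cA cS.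
  have [|||||s [cs ss sA]] := IH (relabel (collapse [set a; b] b) e) (S :\ a) (A :\ k).
  - by lia.
  - by lia.
  - by move=> i c; rewrite in_setD1 => /andP[_ /(ends i c)[p q]]; split;
      apply: collapse2_in.
  - by rewrite !inE eq_sym kj.
  - exact: np'.
  have [||||s' [cs' ss' s'A]] := @rainbow_closed_collapse_bound _ _ [set a;
    b] b [set k] e 1 s.
  - exact: bX.
  - by move=> p q pX qX pq; apply: edge_connects ab _ _ pq.
  - exact: cs.
  - by move=> d /sA; rewrite !inE => /andP[].
  exists s'; split=> //; first by lia.
  by move=> d /s'A/orP[/sA/setD1P[]|/set1P->].
have cA := cardsD1 j A; rewrite jA in cA.
(* Two colours that are both stuck share the unique leaf pair of [j], so they have parallel
   edges. *)
have /card_gt1P[k [i [kA iA ki]]] : 1 < #|A :\ j| by lia.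
move: kA iA; rewrite !inE => /andP[kj kA] /andP[ij iA].
case: (step k kA kj) => // -[w [nab wa wb]];
  case: (step i iA ij) => // -[w' [nab' wa' wb']].
have [_ /parallelP P] := star_leaves wa wb nab (nl _ _ _ jA wa) (nl _ _ _ jA wb) wa' wb' nab'.
apply: (@digon k i (e k true).1 (e k true).2); rewrite ?adj_edge //.
by case: P => -[<- <-]; rewrite ?adj_edge // adj_sym adj_edge.
Qed.

End Pigeonhole.

(** * The induction statement and its use for contractions *)

Definition short_rainbow_closed (n : nat) : Prop :=
  forall (V C : finType) (e : C -> bool -> V * V),
    #|V| = n -> 0 < n <= #|C| ->
    (forall k, ~~ parallel (e k true) (e k false)) ->
    exists2 s, rainbow_closed e s & size s <= uphalf n.

(** [K] collects the lost colours. The vertices in [S] and the colours outside [K] are made into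
    types of their own, and the walk found there is carried back. *)
Lemma short_rainbow_closed_relabel (V C : finType) (e : C -> bool -> V * V)
    (f : V -> V) (S : {set V}) (K : {set C}) :
  short_rainbow_closed #|S| ->
  (forall x, f x \in S) -> 0 < #|S| -> #|S| + #|K| <= #|C| ->
  (forall k, k \notin K -> ~~ parallel (relabel f e k true) (relabel f e k false)) ->
  exists s, [/\ rainbow_closed (relabel f e) s, size s <= uphalf #|S| &
                forall d, d \in s -> col d \notin K].
Proof.
move=> IH fS S0 SK np.
pose V' : finType := {x : V | x \in S}; pose C' : finType := {k : C | k \notin K}.
pose e' (k : C') b : V' * V' :=
  (exist _ (f (e (val k) b).1) (fS _), exist _ (f (e (val k) b).2) (fS _)).
have cV' : #|V'| = #|S| by rewrite card_sig.
have cC' : #|C'| = #|~: K| by rewrite card_sig; apply: eq_card => k; rewrite !inE.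
have [|[k kK]|s [s0 us [p w]] ss] := IH V' C' e' cV'.
- by have := cardsC K; lia.
- apply: contra (np k kK) => /=; rewrite /e' /relabel /=.
  by case/parallelP=> -[] /(congr1 val)/= E1 /(congr1 val)/= E2; apply/parallelP; auto.
pose g (d : C' * bool * bool) : C * bool * bool := (val d.1.1, d.1.2, d.2).
have wg x t y : walk e' x t y -> walk (relabel f e) (val x) (map g t) (val y).
  elim: t x => [|d t IHt] x /=; first by move/eqP->.
  case/andP=> /eqP<- /IHt.
  have -> : val (tgt e' d) = tgt (relabel f e) (g d) by rewrite /tgt /=; case: (d.2).
  have -> : val (src e' d) = src (relabel f e) (g d) by rewrite /src /=; case: (d.2).
  by move=> ->; rewrite eqxx.
exists (map g s); split.
- split; first by case: (s) s0.
    have -> : map (@col C) (map g s) = map val (map (@col C') s) by rewrite -!map_comp.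
    by rewrite map_inj_uniq //; apply: val_inj.
  by exists (val p); apply: wg.
- by rewrite size_map.
by move=> d /mapP[[[[k kK] b] r] _ ->].
Qed.

(** * Constraints on a counterexample *)

Section Counterexample.

Variables (V C : finType) (e : C -> bool -> V * V) (h : nat).
Hypothesis proper : forall k, ~~ parallel (e k true) (e k false).
Hypothesis long : forall s, rainbow_closed e s -> h < size s.

Lemma close_edge p s q k : s != [::] -> walk e p s q -> uniq (map (@col C) s) ->
  adj e k q p -> (forall d, d \in s -> col d != k) -> h <= size s.
Proof.
move=> s0 w us /adj_walk[d dk wd] ks.
have := @long (s ++ [:: d]); rewrite size_cat addn1 ltnS; apply.
apply: rainbow_closed_cat w wd us _ _ => // x y xs; rewrite mem_seq1 => /eqP->.
by rewrite dk ks.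
Qed.

Lemma adj_irr k x y : 0 < h -> adj e k x y -> x != y.
Proof.
move=> h0 xy; apply/negP=> /eqP E; rewrite -E in xy.
by have [d /long] := rainbow_closed1 xy; rewrite ltnNge h0.
Qed.

Lemma adj_inj k j x y : 1 < h -> adj e k x y -> adj e j x y -> k = j.
Proof.
move=> h1 xy; rewrite adj_sym => yx; apply/eqP/negP=> /negP kj.
have [d dk wd] := adj_walk xy.
have := close_edge (s := [:: d]) isT wd isT yx; rewrite leqNgt h1; move=> H.
by suff: false by []; apply: H => z; rewrite mem_seq1 => /eqP->; rewrite dk.
Qed.

Lemma no_triangle i j k x y z : 2 < h -> i != j -> j != k -> i != k ->
  adj e i x y -> adj e j y z -> adj e k z x -> False.
Proof.
move=> h2 ij jk ik /adj_walk[d di wd] /adj_walk[d' d'j wd'] zx.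
have w : walk e x [:: d; d'] z.
  by rewrite -cat1s; apply/walk_cat; exists y.
have := close_edge (s := [:: d; d']) isT w _ zx; rewrite leqNgt h2; move=> H.
suff: false by []; apply: H; first by rewrite /= mem_seq1 di d'j ij.
by move=> a; rewrite !inE => /orP[]/eqP->; rewrite ?di ?d'j.
Qed.

Lemma star_centre_colour k j u v y w : 1 < h ->
  adj e k u v -> adj e k u y -> v != y -> adj e j u y -> adj e j u w -> w != y -> w = v.
Proof.
move=> h1 uv uy vy uy' uw wy; have jk := adj_inj h1 uy' uy; rewrite jk in uw.
have nu x z : adj e k x z -> x != z by apply: adj_irr; lia.
have [/parallelP[][E1 E2]|/parallelP[][E1 E2]] := orP (adj_two uv uy vy uw) => //.
- by have := nu _ _ uv; rewrite -E1 eqxx.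
- by rewrite E2 eqxx in wy.
- by have := nu _ _ uy; rewrite -E1 eqxx.
Qed.

(** For an edge [ab] this is the obstruction to contracting it: the edges of the star become
    parallel, so its colour is lost too. *)
Definition leaf_pair a b : bool := [exists j, [exists w, adj e j w a && adj e j w b]].

Lemma leaf_pairC a b : leaf_pair a b = leaf_pair b a.
Proof. by apply: eq_existsb => j; apply: eq_existsb => w; rewrite andbC. Qed.

Lemma leaf_pairI j w a b : adj e j w a -> adj e j w b -> leaf_pair a b.
Proof. by move=> wa wb; apply/existsP; exists j; apply/existsP; exists w; rewrite wa. Qed.

Lemma parallel_edge_eq k b k' b' : 1 < h ->
  parallel (e k' b') (e k b) -> (k, b) = (k', b').
Proof.
move=> h1 P; have kk : k = k'.
  apply: (adj_inj h1 (adj_edge e k b)).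
  move: P (adj_edge e k' b'); case: (e k b) (e k' b') => x y [x' y'] /= /parallelP[][-> ->] //.
  by rewrite adj_sym.
subst k'; congr (_, _); apply/eqP; apply: contraNT (proper k) => bb'.
move: P; case: b b' bb' => [] [] // _.
by case: (e k false) (e k true) => a c [a' c'] /parallelP[][-> ->]; apply/parallelP; auto.
Qed.

(* Mapping each edge of a colour in [A] to a star having that edge as leaf pair is
   injective, so [2 #|A| <= #|A|]. *)
Lemma leaf_pair_family (A : {set C}) : 1 < h ->
  (forall k b, k \in A -> exists j w,
     [/\ j \in A, adj e j w (e k b).1 & adj e j w (e k b).2]) -> A = set0.
Proof.
move=> h1 bad.
have H (p : C * bool) : exists j, p.1 \in A ->
    j \in A /\ exists w, adj e j w (e p.1 p.2).1 /\ adj e j w (e p.1 p.2).2.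
  case: p => k b /=; have [kA|kA] := boolP (k \in A); last by exists k.
  by have [j [w [jA a1 a2]]] := bad k b kA; exists j => _; split=> //; exists w.
have [F HF] := fin_all_exists H.
have nl k x y : adj e k x y -> x != y by apply: adj_irr; lia.
have injF : {in setX A [set: bool] &, injective F}.
  move=> [k b] [k' b']; rewrite !inE !andbT /= => kA k'A EF.
  have [_ [w [wa wb]]] := HF (k, b) kA; have [_ [w' [wa' wb']]] := HF (k', b') k'A.
  rewrite EF /= in wa wb; rewrite /= in wa' wb'.
  have nb := nl _ _ _ (adj_edge e k b); have nb' := nl _ _ _ (adj_edge e k' b').
  have [_ P] := star_leaves wa wb nb (nl _ _ _ wa) (nl _ _ _ wb) wa' wb' nb'.
  by apply: parallel_edge_eq; rewrite // [e k b]surjective_pairing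
    [e k' b']surjective_pairing.
have sub : F @: setX A [set: bool] \subset A.
  apply/subsetP=> j /imsetP[[k b]]; rewrite !inE andbT => kA ->.
  by have [] := HF (k, b) kA.
have := subset_leq_card sub; rewrite card_in_imset // cardsX cardsT card_bool.
by move=> A2; apply/eqP; rewrite -cards_eq0; lia.
Qed.

Hypothesis VC : #|V| <= #|C|.
Hypothesis IH : forall m, m < #|V| -> short_rainbow_closed m.

(** Fewer than [#|X|] colours are lost, so the contraction still has at least as many colours as
    vertices. Its short walk lifts at a cost of at most [D]. *)
Lemma contraction (X : {set V}) x0 (K : {set C}) D : x0 \in X -> 1 < #|X| ->
  #|K| < #|X| ->
  (forall k a b, k \notin K -> a \in X -> b \in X -> ~~ adj e k a b) ->
  (forall k w a b, k \notin K -> w \notin X -> a \in X -> b \in X -> a != b ->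
     adj e k w a -> adj e k w b -> False) ->
  (forall p q, p \in X -> q \in X -> p != q ->
     exists t, [/\ walk e p t q, uniq (map (@col C) t), size t <= D &
                   forall d, d \in t -> col d \in K]) ->
  h < uphalf (#|V|.+1 - #|X|) + D.
Proof.
move=> x0X X1 KX inX outX conn.
have cS : #|x0 |: ~: X| = (#|V|.+1 - #|X|)%N.
  by rewrite cardsU1 !inE x0X; have := cardsC X; lia.
have mX := subset_leq_card (subsetT X); rewrite cardsT in mX.
have [|||||s [cs ss sK]] :=
    @short_rainbow_closed_relabel V C e (collapse X x0) (x0 |: ~: X) K.
- by apply: IH; lia.
- by move=> x; rewrite /collapse !inE; case: ifP => [|->]; rewrite ?eqxx ?orbT.
- by lia.
- by lia.
- move=> k kK; apply/negP=> P.
  have [[a [b [aX bX ab]]]|[w [a [b [wX aX bX [nab wa wb]]]]]] :=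
    collapse_parallel x0X (proper k) P.
    by have := inX k a b kK aX bX; rewrite ab.
  exact: outX kK wX aX bX nab wa wb.
have [s' [/long ls ss' _]] := rainbow_closed_collapse_bound x0X conn cs sK.
by lia.
Qed.

(** Otherwise [ab] can be contracted with [k] as the only lost colour. The condition on [h] holds
    for odd order, where removing one vertex lowers the rounded half. *)
Lemma edge_leaf_pair k a b : 1 < h -> uphalf #|V|.-1 < h -> adj e k a b -> leaf_pair a b.
Proof.
move=> h1 hV ab; have nab : a != b by apply: adj_irr ab; lia.
apply: contraLR hV => nb; rewrite -leqNgt.
have c2 : #|[set a; b]| = 2 by rewrite cards2 nab.
suff : h < uphalf (#|V|.+1 - #|[set a; b]|) + 1 by rewrite c2; lia.
apply: (@contraction [set a; b] a [set k]); rewrite ?c2 ?cards1 ?inE ?eqxx //.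
- move=> j x y; rewrite inE => jk xX yX; apply/negP=> xy.
  have := adj_irr (ltnW h1) xy; move: xX yX xy; rewrite !inE.
  move=> /pred2P[]-> /pred2P[]->;
    rewrite ?eqxx // 1?[adj e j b a]adj_sym => /(adj_inj h1 ab) E;
    by rewrite -E eqxx in jk.
- move=> j w x y _ _ xX yX nxy wx wy; case/negP: nb.
  move: xX yX nxy wx wy; rewrite !inE => /pred2P[]-> /pred2P[]->;
    rewrite ?eqxx // => _ wx wy.
    exact: leaf_pairI wx wy.
  exact: leaf_pairI wy wx.
by move=> p q; apply: edge_connects ab.
Qed.


(** * Even order: stars with an edge that is not a leaf pair *)

Hypothesis h3 : 2 < h.
Hypothesis Vh : #|V| = h.*2.

Let h2 : 1 < h. Proof. exact: ltnW. Qed.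
Let h1 : 0 < h. Proof. exact: ltnW. Qed.

(* Contracting [uv] and [yy'] yields a rainbow [u]-[v] walk of length [h] through [y];
   the chord [uy] has the colour of [uv] and shortcuts it. *)
Lemma good_star_sibling k k' u v y y' : adj e k u v -> adj e k u y -> v != y ->
  ~~ leaf_pair u v -> adj e k' y y' -> y' != u -> y' != v -> leaf_pair y y'.
Proof.
move=> uv uy vy guv yy' y'u y'v; apply: contraT => gyy'.
have nuv := adj_irr h1 uv; have nuy := adj_irr h1 uy; have nyy' := adj_irr h1 yy'.
have kk' : k != k'.
  apply/eqP=> E; rewrite -E in yy'; have := adj_two uv uy vy yy'.
  by case/orP=> /parallelP[][E1 E2]; move: nuy vy y'u y'v; rewrite ?E1 ?E2 ?eqxx.
pose X1 := [set v; u]; pose X2 := [set y'; y].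
pose e1 := relabel (collapse X1 u) e; pose f x := collapse X2 y (collapse X1 u x).
have uX1 : u \in X1 by rewrite set22.
have yX2 : y \in X2 by rewrite set22.
have yX1 : y \notin X1 by rewrite !inE negb_or ![y == _]eq_sym vy nuy.
have y'X1 : y' \notin X1 by rewrite !inE negb_or y'v.
have outX1 x a : collapse X1 u x = a -> a \notin X1 -> x = a.
  move=> E aX; have : collapse X1 u x = collapse X1 u a by rewrite E collapse_out.
  by case/(collapse_inj uX1)=> // -[_ /idPn].
have conn1 p q : p \in X1 -> q \in X1 -> p != q ->
     exists t, [/\ walk e p t q, uniq (map (@col C) t), size t <= 1 &
                   forall d, d \in t -> col d \in [set k]].
  by apply: edge_connects; rewrite adj_sym.
have proper1 j : j != k -> ~~ parallel (e1 j true) (e1 j false).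
  move=> jk; apply/negP=> P.
  have [[a [b [aX bX ab]]]|[w [a [b [wX aX bX [nab wa wb]]]]]] :=
    collapse_parallel uX1 (proper j) P.
    have := adj_irr h1 ab; move: aX bX ab; rewrite !inE => /pred2P[]-> /pred2P[]->;
      rewrite ?eqxx // 1?[adj e j v u]adj_sym => /(adj_inj h2 uv) E;
        by rewrite E eqxx in jk.
  case/negP: guv; move: aX bX nab wa wb; rewrite !inE => /pred2P[]-> /pred2P[]->;
    rewrite ?eqxx // => _ wa wb; first exact: leaf_pairI wb wa.
  exact: leaf_pairI wa wb.
(* A star spoiled only by the second contraction has edges to [y] and [y'] from one vertex, or from
   [u] and [v]. The former makes [yy'] a leaf pair; the latter gives the triangle [uyy'] or a second
   colour on [uy]. *)
have proper2 j : j \notin [set k; k'] ->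
    ~~ parallel (relabel f e j true) (relabel f e j false).
  rewrite !inE negb_or => /andP[jk jk']; apply/negP=> P.
  have [[a [b [aX bX ab]]]|[w [a [b [wX aX bX [nab wa wb]]]]]] :=
      @collapse_parallel _ _ X2 y e1 j yX2 (proper1 j jk) P.
    have X21 x : x \in X2 -> x \notin X1 by move=> /set2P[]->.
    have [x [z [xz Ex Ez]]] := adj_relabel ab.
    have {}Ex := outX1 _ _ Ex (X21 _ aX); have {}Ez := outX1 _ _ Ez (X21 _ bX); subst x z.
    have := adj_irr h1 xz; move: aX bX xz; rewrite !inE => /pred2P[]-> /pred2P[]->;
      rewrite ?eqxx // 1?[adj e j y' y]adj_sym => /(adj_inj h2 yy') E;
        by rewrite E eqxx in jk'.
  have [wy wy'] : adj e1 j w y /\ adj e1 j w y'.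
    by move: aX bX nab wa wb; rewrite !inE => /pred2P[]-> /pred2P[]->; rewrite ?eqxx.
  have [x1 [z1 [xz1 Ex1 Ez1]]] := adj_relabel wy.
  have [x2 [z2 [xz2 Ex2 Ez2]]] := adj_relabel wy'.
  have {}Ez1 := outX1 _ _ Ez1 yX1; have {}Ez2 := outX1 _ _ Ez2 y'X1; subst z1 z2.
  have [E|[x1X x2X]] : x1 = x2 \/ x1 \in X1 /\ x2 \in X1.
    by apply: (collapse_inj uX1); rewrite Ex1 Ex2.
    by subst x2; rewrite (leaf_pairI xz1 xz2) in gyy'.
  move: x1X x2X xz1 xz2; rewrite !inE => /pred2P[]-> /pred2P[]-> xz1 xz2.
  - by rewrite (leaf_pairI xz1 xz2) in gyy'.
  - by apply: (@no_triangle k k' j u y y'); rewrite // 1?eq_sym // adj_sym.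
  - by rewrite (adj_inj h2 uy xz1) eqxx in jk.
  by rewrite (adj_inj h2 uy xz1) eqxx in jk.
(* With two vertices fewer, the induction gives length at most [h - 1]. *)
have cS : #|[set: V] :\ v :\ y'| = (h.*2 - 2)%N.
  have := cardsD1 y' ([set: V] :\ v); have := cardsD1 v [set: V].
  by rewrite !inE y'v cardsT Vh; clear; lia.
have [|||||s [cs ss sK]] :=
    @short_rainbow_closed_relabel V C e f ([set: V] :\ v :\ y') [set k; k'].
- by apply: IH; rewrite cS Vh; move: h3; clear; lia.
- move=> x; apply: collapse2_in; rewrite 1?eq_sym //; last by rewrite !inE eq_sym vy.
  by apply: collapse2_in; rewrite ?inE 1?eq_sym.
- by rewrite cS; move: h3; clear; lia.
- by rewrite cS cards2 kk'; move: h3 VC; rewrite Vh; clear; lia.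
- exact: proper2.
have {}ss : size s < h by move: ss h3; rewrite cS; clear; lia.
have sk d : d \in s -> (col d != k) && (col d != k') by move/sK; rewrite !inE negb_or.
(* Lifting undoes the contractions in reverse order. A walk that stays closed at [yy'] would lift to
   length at most [h]. *)
have [s1 [s10 us1 ss1 sub1 [cs1|[p [q [pX qX pq w]]]]]] :=
  @rainbow_closed_uncollapse _ _ X2 y e1 s yX2 cs.
  have [|s' [/long ls ss' _]] := rainbow_closed_collapse_bound uX1 conn1 cs1.
    by move=> d /sub1/sk/andP[dk _]; rewrite inE.
  by move: ss ss1 ls ss'; clear; lia.
have qp : adj e k' q p.
  by move: pX qX pq; rewrite !inE => /pred2P[]-> /pred2P[]->; rewrite ?eqxx // adj_sym.
have pX1 : p \notin X1 by case/set2P: pX => ->.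
have qX1 : q \notin X1 by case/set2P: qX => ->.
have [d dk' wd] := adj_walk qp.
have wd1 : walk e1 q [:: d] p.
  move: wd => /=; rewrite src_relabel tgt_relabel andbC => /andP[/eqP-> /eqP->].
  by rewrite !collapse_out ?eqxx.
have cs2 : rainbow_closed e1 (s1 ++ [:: d]).
  apply: rainbow_closed_cat w wd1 us1 _ _ => // a b /sub1/sk/andP[_ ak'].
  by rewrite mem_seq1 => /eqP->; rewrite dk'.
have k2 a : a \in s1 ++ [:: d] -> col a != k.
  rewrite mem_cat mem_seq1 => /orP[/sub1/sk/andP[]//|/eqP->].
  by rewrite dk' eq_sym.
have [s3 [s30 us3 ss3 sub3 [/long|[p3 [q3 [p3X q3X pq3 w3]]]]]] :=
  rainbow_closed_uncollapse uX1 cs2.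
  by move: ss3 ss ss1; rewrite size_cat addn1; clear; lia.
have k3 a : a \in s3 -> col a != k by move/sub3/k2.
have qp3 : adj e k q3 p3.
  by move: p3X q3X pq3; rewrite !inE => /pred2P[]-> /pred2P[]->; rewrite ?eqxx // adj_sym.
have hs3 := close_edge s30 w3 us3 qp3 k3.
(* Without [d], the walk uses only edges of [s1], hence fewer than [h], too few for closing it with
   colour [k]. *)
have ds3 : d \in s3.
  apply: contraTT hs3 => ds3; rewrite -ltnNge.
  apply: leq_ltn_trans (leq_ltn_trans ss1 ss); apply: uniq_leq_size (map_uniq us3) _.
  move=> a as3; have := sub3 a as3; rewrite mem_cat mem_seq1 => /orP[//|/eqP E].
  by rewrite -E as3 in ds3.
(* [d] is an edge at [y], so the walk can be cut at [y]. *)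
have [t1 [t2 [E3 wt1 wt2]]] : exists t1 t2, [/\ s3 = t1 ++ t2, walk e p3 t1 y & walk e y t2 q3].
  have [a [b E3]] : exists a b, s3 = a ++ d :: b.
    by case/splitPr: ds3 => a b; exists a, b.
  move: w3; rewrite E3 => /walk_cat[r wa]; rewrite /= => /andP[/eqP Er wb].
  move: (wd) => /=; rewrite andbC => /andP[/eqP Ep /eqP Eq].
  move: pX qX pq; rewrite !inE -Ep -Eq => /pred2P[] Y1 /pred2P[] Y2;
    rewrite Y1 Y2 ?eqxx // => _.
    exists a, (d :: b); split=> //=; first by rewrite -Y2 Er.
    by rewrite Y2 eqxx.
  exists (rcons a d), b; rewrite cat_rcons -Y1; split=> //.
  by apply: walk_rcons; rewrite ?Er.
have t10 : t1 != [::].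
  by apply/eqP=> E; move: wt1; rewrite E /= => /eqP Ey; rewrite -Ey p3X in yX1.
have t20 : t2 != [::].
  by apply/eqP=> E; move: wt2; rewrite E /= => /eqP Ey; rewrite Ey q3X in yX1.
have sz : size t1 + size t2 <= h by move: ss3 ss ss1; rewrite E3 !size_cat addn1; clear;
  lia.
have [sz1 sz2] : 0 < size t1 /\ 0 < size t2 by rewrite !lt0n !size_eq0.
move: us3; rewrite E3 map_cat cat_uniq => /and3P[ut1 _ ut2].
have kt1 a : a \in t1 -> col a != k by move=> at1; apply: k3; rewrite E3 mem_cat at1.
have kt2 a : a \in t2 -> col a != k by move=> at2; apply: k3; rewrite E3 mem_cat at2 orbT.
(* The part between [u] and [y] is shorter than [h], and [uy] closes it. *)
have [Ep|Eq] : p3 = u \/ q3 = u.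
  by move: p3X q3X pq3; rewrite !inE => /pred2P[]-> /pred2P[]->; rewrite ?eqxx; auto.
  rewrite Ep in wt1; have := fun j => close_edge (k := j) t10 wt1 ut1.
  by move/(_ k); rewrite adj_sym => /(_ uy kt1);
    rewrite leqNgt (leq_trans _ sz) // -addn1 leq_add2l.
rewrite Eq in wt2; have := close_edge t20 wt2 ut2 uy kt2.
by rewrite leqNgt (leq_trans _ sz) // -add1n leq_add2r.
Qed.

(** * Even order: wheels *)

Definition nbr y w : bool := [exists j, adj e j w y].
(** A spoke at [w] of a wheel with hub [y], together with a rim edge from [w] to [w'] of the same
    colour. *)
Definition star_step y w w' : bool := [exists j, adj e j w y && adj e j w w'] && (w' != y).

(** Taking predecessors permutes [M], so [M] is the rim of a wheel with hub [y], whose spokes have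
    distinct colours. The wheel has diameter at most two, and contracting it leaves very few
    vertices. *)
Lemma no_wheel y (M : {set V}) : M != set0 -> {in M, forall w, nbr y w} ->
  (forall w', w' \in M -> exists2 w, w \in M & star_step y w w') -> False.
Proof.
move=> /set0Pn[w0 w0M] Mnbr pred; have /existsP[k0 _] := Mnbr _ w0M.
have /fin_all_exists[g Hg] w : exists j, w \in M -> adj e j w y.
  have [wM|_] := boolP (w \in M); last by exists k0.
  by have /existsP[j wj] := Mnbr _ wM; exists j.
have /fin_all_exists[f Hf] w' : exists w, w' \in M ->
    [/\ w \in M, adj e (g w) w w' & w' != y].
  have [w'M|_] := boolP (w' \in M); last by exists w'.
  have [w wM /andP[/existsP[j /andP[wy ww']] w'y]] := pred _ w'M.
  by exists w => _; split=> //; rewrite -(adj_inj h2 wy (Hg _ wM)).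
have nl k a b : adj e k a b -> a != b by apply: adj_irr.
have gf_inj : {in M &, injective (g \o f)}.
  move=> a b aM bM /= E; have [fa adja ay] := Hf a aM; have [fb adjb nby] := Hf b bM.
  have gfa := Hg _ fa; have gfb := Hg _ fb; rewrite -E in adjb gfb.
  rewrite eq_sym in ay; rewrite eq_sym in nby.
  have [_ /parallelP[[_ //]|[E1]]] :=
    star_leaves gfa adja ay (nl _ _ _ gfa) (nl _ _ _ adja) gfb adjb nby.
  by rewrite E1 eqxx in ay.
have f_inj : {in M &, injective f}.
  by move=> a b aM bM E; apply: gf_inj => //=; rewrite E.
have fM : f @: M = M.
  apply/eqP; rewrite eqEcard card_in_imset // leqnn andbT.
  by apply/subsetP=> w /imsetP[a aM ->]; have [] := Hf a aM.
have succ w : w \in M -> exists2 a, a \in M & adj e (g w) w a.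
  by rewrite -{1}fM => /imsetP[a aM ->]; exists a => //; have [] := Hf a aM.
have g_inj : {in M &, injective g}.
  move=> a b; rewrite -{1 2}fM => /imsetP[a' a'M ->] /imsetP[b' b'M ->] E.
  by congr f; apply: gf_inj.
have yM : y \notin M by apply/negP=> yM; have [_ _] := Hf y yM; rewrite eqxx.
pose K := g @: M; have cK : #|K| = #|M| by rewrite card_in_imset.
have gK w : w \in M -> g w \in K by apply: imset_f.
(* The rim consists of [#|M|] edges of distinct colours on [#|M|] vertices. *)
have gap : h < #|M|.
  have /fin_all_exists[sel Hsel] k : exists b, k \in K -> (e k b).1 \in M /\ (e k b).2 \in M.
    have [/imsetP[w wM ->]|_] := boolP (k \in K); last by exists true.
    have [a aM /existsP[b Eb]] := succ w wM; exists b => _; move: Eb.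
    by case: (e (g w) b) => x z /parallelP[][-> ->].
  have M0 : 0 < #|M| by apply/card_gt0P; exists w0.
  have [|s [/long ls ss _]] := pigeonhole_rainbow_closed _ Hsel;
    first by rewrite cK M0 leqnn.
  exact: leq_trans ls ss.
pose X := y |: M; have yX : y \in X by rewrite setU11.
have inX k a b : k \notin K -> a \in X -> b \in X -> ~~ adj e k a b.
  move=> kK aX bX; apply/negP=> ab.
  have ky w : w \in M -> adj e k y w -> False.
    by rewrite adj_sym => wM /(adj_inj h2 (Hg _ wM)) E; rewrite -E gK in kK.
  case/setU1P: aX bX ab => [->|aM] /setU1P[->|bM] ab.
  - by have := nl _ _ _ ab; rewrite eqxx.
  - exact: ky bM ab.
  - by rewrite adj_sym in ab; exact: ky aM ab.
  have kg w : w \in M -> k != g w by move=> wM; apply: contraNneq kK => ->; apply: gK.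
  have gab : g a != g b by apply: contraNneq (nl _ _ _ ab) => /g_inj->.
  apply: (@no_triangle (g a) k (g b) y a b h3); rewrite ?kg ?(eq_sym (g a) k) ?kg //.
    by rewrite adj_sym Hg.
  exact: Hg.
have conn p q : p \in X -> q \in X -> p != q ->
     exists t, [/\ walk e p t q, uniq (map (@col C) t), size t <= 2 &
                   forall d, d \in t -> col d \in K].
  case/setU1P=> [->|pM] /setU1P[->|qM]; rewrite ?eqxx // => pq.
  - have [|d dk wd] := @adj_walk _ _ e (g q) y q; first by rewrite adj_sym Hg.
    by exists [:: d]; split=> // x; rewrite mem_seq1 => /eqP->; rewrite dk gK.
  - have [d dk wd] := adj_walk (Hg _ pM).
    by exists [:: d]; split=> // x; rewrite mem_seq1 => /eqP->; rewrite dk gK.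
  have [d dk wd] := adj_walk (Hg _ pM).
  have [|d' dk' wd'] := @adj_walk _ _ e (g q) y q; first by rewrite adj_sym Hg.
  exists ([:: d] ++ [:: d']); split=> //.
  - by apply/walk_cat; exists y.
  - rewrite /= mem_seq1 dk dk' andbT; apply: contraNneq pq => E; apply/eqP.
    exact: g_inj.
  by move=> x; rewrite !inE => /orP[]/eqP->; rewrite ?dk ?dk' gK.
have cX : #|X| = #|M|.+1 by rewrite cardsU1 yM.
have cXC := cardsC X; have cKC := cardsC K.
pose S := y |: ~: X; have cS : #|S| = (#|~: X|).+1 by rewrite cardsU1 !inE eqxx.
pose e' := relabel (collapse X y) e.
(* At most [h - 1] vertices remain, so the strict pigeonhole bound gives length at most [h - 2], and
   lifting adds at most two. *)
have [/exists_inP[j jK npj]|allp] :=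
    boolP [exists j in ~: K, ~~ parallel (e' j true) (e' j false)].
  have [||s [cs ss sK]] := @pigeonhole_rainbow_closed_proper _ _ e' S (~: K) j _ _ jK npj.
  - by move: VC; rewrite cS -cXC -cKC cX cK; clear; lia.
  - have Sx x : collapse X y x \in S.
      by rewrite /collapse; case: ifP => xX; rewrite in_setU1 ?eqxx // inE xX orbT.
    by move=> k b _; split; apply: Sx.
  have [|s' [/long ls ss' _]] := rainbow_closed_collapse_bound yX conn cs.
    by move=> d /sK; rewrite inE.
  by move: ls ss' ss gap cXC; rewrite cS cX Vh; clear; lia.
(* Now every colour outside [K] is a star with its centre outside [X] and its leaves in [X]. There
   are more such colours than centres, so two stars share a centre. *)
have /fin_all_exists[p Hp] j : exists w, j \in ~: K -> exists a b,
   [/\ w \notin X, a \in X, b \in X & [/\ a != b, adj e j w a & adj e j w b]].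
  have [jK|_] := boolP (j \in ~: K); last by exists y.
  have pj : parallel (e' j true) (e' j false).
    by apply: contraNT allp => npj; apply/exists_inP; exists j.
  have [[a [b [aX bX ab]]]|[w [a [b H]]]] := collapse_parallel yX (proper j) pj.
    by rewrite inE in jK; have := inX j a b jK aX bX; rewrite ab.
  by exists w => _; exists a, b.
have [j [j' [jK j'K jj' pp]]] : exists j j', [/\ j \in ~: K, j' \in ~: K, j != j' & p j = p j'].
  have : ~~ (#|~: K| <= #|~: X|) by move: VC cXC cKC gap; rewrite cX cK; clear; lia.
  have sub : p @: (~: K) \subset ~: X.
    by apply/subsetP=> w /imsetP[j jK ->]; have [a [b [pX _ _ _]]] :=
      Hp j jK; rewrite in_setC.
  move=> nle; have [/existsP[j /existsP[j' /and4P[jK j'K jj' /eqP E]]]|nex] :=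
    boolP [exists j, exists j', [&& j \in ~: K, j' \in ~: K, j != j' & p j == p j']].
    by exists j, j'; split.
  case/negP: nle; rewrite -(card_in_imset (f := p)) ?subset_leq_card //.
  move=> j j' jK j'K E; apply/eqP; apply: contraNT nex => jj'.
  by apply/existsP; exists j; apply/existsP; exists j'; rewrite jK j'K jj' E eqxx.
have [a [a' [pX aX a'X [aa' pa pa']]]] := Hp j jK.
have [b [b' [_ bX b'X [bb' pb pb']]]] := Hp j' j'K; rewrite -pp in pb pb'.
move: (p j) pX pa pa' pb pb' => {pp}v vX va va' vb vb'.
rewrite inE in jK; rewrite inE in j'K.
have nab x z : adj e j v x -> adj e j' v z -> x != z.
  move=> vx vz; apply: contraNneq jj' => E; rewrite -E in vz.
  by rewrite (adj_inj h2 vx vz).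
have tri i x z : i \in K -> adj e j v x -> adj e j' v z -> adj e i x z -> False.
  move=> iK vx vz xz; apply: (@no_triangle j i j' v x z h3) => //.
  - by apply: contraNneq jK => ->.
  - by apply: contraNneq j'K => <-.
  by rewrite adj_sym.
(* A rainbow closed walk of length at most four runs from [v] over [a] and [b] back to [v], which
   leaves only [h = 3]. *)
have [h4|h4] := ltnP 3 h.
  have [t [wt ut st tK]] := conn a b aX bX (nab _ _ va vb).
  have [d dj wd] := adj_walk va; rewrite adj_sym in vb.
  have w : walk e v ([:: d] ++ t) b by apply/walk_cat; exists a.
  have := close_edge (s := [:: d] ++ t) isT w _ vb.
  have dt : j \notin map (@col C) t.
    by apply: contra jK => /mapP[x xt ->]; apply: tK.
  rewrite /= dj dt ut => /(_ isT) H.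
  have : h <= (size t).+1.
    apply: H => x; rewrite inE => /orP[/eqP->|/tK xK]; first by rewrite dj.
    by apply: contraNneq j'K => <-.
  by move: st h4; clear; lia.
have M4 : #|M| <= 4.
  have : 0 < #|~: X| by apply/card_gt0P; exists v; rewrite inE.
  by move: cXC h4; rewrite cX Vh; clear; lia.
have yadj w : w \in X -> w != y -> exists2 i, i \in K & adj e i y w.
  case/setU1P=> [->|wM _]; first by rewrite eqxx.
  by exists (g w); rewrite ?gK // adj_sym Hg.
have [ay|ay] := eqVneq a y.
  have [|i iK yb] := yadj b bX; first by rewrite -ay eq_sym; apply: nab.
  by apply: (tri i a b) => //; rewrite ay.
have [ay'|ay'] := eqVneq a' y.
  have [|i iK yb] := yadj b bX; first by rewrite -ay' eq_sym; apply: nab.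
  by apply: (tri i a' b) => //; rewrite ay'.
have [yb|yb] := eqVneq b y.
  have [//|i iK xy] := yadj a aX.
  by apply: (tri i a b) => //; rewrite yb adj_sym.
have [yb'|yb'] := eqVneq b' y.
  have [//|i iK xy] := yadj a aX.
  by apply: (tri i a b') => //; rewrite yb' adj_sym.
have XM x : x \in X -> x != y -> x \in M by case/setU1P=> // ->; rewrite eqxx.
have [aM a'M bM b'M] := And4 (XM _ aX ay) (XM _ a'X ay') (XM _ bX yb) (XM _ b'X yb').
have EM : [set a; a'; b; b'] = M.
  apply/eqP; rewrite eqEcard; apply/andP; split.
    by apply/subsetP=> x; rewrite !inE => /orP[/orP[/orP[]|]|] /eqP->.
  apply: leq_trans M4 _; rewrite -setUA cardsU !cards2 aa' bb'.
  suff -> : [set a; a'] :&: [set b; b'] = set0 by rewrite cards0.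
  apply/setP=> x; rewrite !inE; apply/negP=> /andP[/orP[]/eqP-> /orP[]/eqP E].
  - by have := nab _ _ va vb; rewrite E eqxx.
  - by have := nab _ _ va vb'; rewrite E eqxx.
  - by have := nab _ _ va' vb; rewrite E eqxx.
  by have := nab _ _ va' vb'; rewrite E eqxx.
(* The four leaves make up [M]. A rim edge between leaves of different stars closes a triangle at
   [v], so the rim edges from [a] and [a'] lead to each other, in two different colours. *)
have other x x' : adj e j v x -> x \in M -> [set x; x'; b; b'] = M -> adj e (g x) x x'.
  move=> vx xM EM'; have [z zM xz] := succ x xM.
  have nxz := nl _ _ _ xz.
  move: zM nxz xz; rewrite -EM' !inE => /orP[/orP[/orP[]|]|] /eqP->;
    rewrite ?eqxx // => _ xz.
    by case: (tri (g x) x b) => //; apply: gK.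
  by case: (tri (g x) x b') => //; apply: gK.
have aa := other a a' va aM EM.
have a'a : adj e (g a') a' a by apply: other; rewrite // -EM [[set a'; a]]setUC.
rewrite adj_sym in a'a.
by case/eqP: aa'; apply: g_inj => //; apply: adj_inj aa a'a.
Qed.

(** If [uv] is not a leaf pair, every neighbour of [y] except possibly [u] has a predecessor: [v]
    has [u], the others get one from [good_star_sibling]. As wheels are impossible, either [u] is
    the only neighbour of [y] or the triangle [uvy] remains; both can be contracted. *)
Lemma star_edges_leaf_pair k u v y : adj e k u v -> adj e k u y -> v != y -> leaf_pair u v.
Proof.
move=> uv uy vy; apply: contraT => guv.
have nl j a b : adj e j a b -> a != b by apply: adj_irr.
have nuv := nl _ _ _ uv; have nuy := nl _ _ _ uy.
have uN : nbr y u by apply/existsP; exists k.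
have pred w' : nbr y w' -> w' != u -> exists2 w, nbr y w & star_step y w w'.
  move=> /existsP[j w'y] w'u; have nw' := nl _ _ _ w'y.
  have [->|w'v] := eqVneq w' v.
    exists u => //; rewrite /star_step vy andbT.
    by apply/existsP; exists k; rewrite uv uy.
  rewrite adj_sym in w'y.
  have /existsP[i /existsP[w /andP[wy ww']]] :=
    good_star_sibling uv uy vy guv w'y w'u w'v.
  exists w; first by apply/existsP; exists i.
  by rewrite /star_step nw' andbT; apply/existsP; exists i; rewrite wy.
have stepu w' : star_step y u w' -> w' = v.
  by case/andP=> /existsP[j /andP[uy' uw]]; apply: star_centre_colour uv uy vy uy' uw.
pose N := [set w | nbr y w]; pose N' := N :\ u.
have [/existsP[b bu]|nou] := boolP [exists b, star_step y b u].
  case: (@no_wheel y N).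
  - by apply/set0Pn; exists u; rewrite inE.
  - by move=> w; rewrite inE.
  move=> w'; rewrite inE => w'N; have [->|w'u] := eqVneq w' u.
    exists b => //; rewrite inE; case/andP: bu => /existsP[j /andP[bj _]] _.
    by apply/existsP; exists j.
  by have [w wN ww'] := pred w' w'N w'u; exists w; rewrite ?inE.
(* By [stepu] only [v] can have [u] as predecessor, so once [u] is removed just [v] may need another
   one. *)
have no_wheel' : N' != set0 -> (nbr y v -> exists2 w, w != u & star_step y w v) -> False.
  move=> N'0 Hv; apply: (@no_wheel y N') => //; first by move=> w; rewrite !inE => /andP[].
  move=> w'; rewrite !inE => /andP[w'u w'N].
  have nb w : star_step y w w' -> nbr y w.
    by case/andP=> /existsP[j /andP[wj _]] _; apply/existsP; exists j.
  have [E|w'v] := eqVneq w' v.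
    rewrite E in w'N nb *; have [w wu ww'] := Hv w'N; exists w => //.
    by rewrite !inE wu nb.
  have [w wN ww'] := pred w' w'N w'u; exists w => //; rewrite !inE wN andbT.
  by apply: contraNneq w'v => E; rewrite E in ww'; rewrite (stepu _ ww').
have [vN|vN] := boolP (nbr y v); last first.
  have [N'0|/no_wheel'[]//] := eqVneq N' set0; last by move=> vN'; rewrite vN' in vN.
  have only j w : adj e j w y -> w = u.
    move=> wy; have : w \notin N' by rewrite N'0 inE.
    rewrite !inE negb_and negbK => /orP[/eqP//|/negP[]].
    by apply/existsP; exists j.
  (* All edges at [y] have the lost colour [k], so the lift avoids [y] and costs nothing. *)
  pose X := [set u; y].
  have cX : #|X| = 2 by rewrite cards2 nuy.
  have uX : u \in X by rewrite set21.
  have cS : #|u |: ~: X| = (h.*2).-1.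
    by rewrite cardsU1 !inE eqxx; have := cardsC X; rewrite cX Vh; clear; lia.
  have [|||||s [cs ss sK]] :=
      @short_rainbow_closed_relabel V C e (collapse X u) (u |: ~: X) [set k].
  - by apply: IH; rewrite cS Vh; move: h3; clear; lia.
  - by move=> x; rewrite /collapse; case: ifP => xX; rewrite in_setU1 ?eqxx // inE xX orbT.
  - by rewrite cS; move: h3; clear; lia.
  - by rewrite cS cards1; move: VC h3; rewrite Vh; clear; lia.
  - move=> j; rewrite inE => jk; apply/negP=> P.
    have [[a [b [aX bX ab]]]|[w [a [b [wX aX bX [nab wa wb]]]]]] :=
        collapse_parallel uX (proper j) P.
      have := nl _ _ _ ab; move: aX bX ab; rewrite !inE => /pred2P[]-> /pred2P[]->;
        rewrite ?eqxx // 1?[adj e j y u]adj_sym => /(adj_inj h2 uy) E;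
          by rewrite E eqxx in jk.
    have wy : adj e j w y.
      by move: aX bX nab wa wb; rewrite !inE => /pred2P[]-> /pred2P[]->; rewrite ?eqxx.
    by rewrite (only _ _ wy) uX in wX.
  have {}ss : size s <= h by move: ss h3; rewrite cS; clear; lia.
  have dy d : d \in s -> src e d != y /\ tgt e d != y.
    move=> /sK; rewrite inE => dk; have ad := adj_dart e d; split; apply/eqP=> E.
      rewrite adj_sym E in ad; have E' := only _ _ ad; rewrite E' in ad.
      by rewrite (adj_inj h2 ad uy) eqxx in dk.
    rewrite E in ad; have E' := only _ _ ad; rewrite E' in ad.
    by rewrite (adj_inj h2 ad uy) eqxx in dk.
  have [s1 [s10 _ ss1 sub1 [/long ls|[p [q [pX qX pq w]]]]]] :=
    rainbow_closed_uncollapse uX cs.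
    by rewrite ltnNge (leq_trans ss1 ss) in ls.
  suff : (p != y) && (q != y).
    by move: pX qX pq; rewrite !inE => /pred2P[]-> /pred2P[]->; rewrite ?eqxx ?andbF.
  case: s1 s10 {ss1} sub1 w => // d s1 _ sub1 w; apply/andP; split.
    move: w => /= /andP[/eqP<- _]; apply: (dy d _).1; apply: sub1; exact: mem_head.
  elim/last_ind: s1 sub1 w => [|s1 d' _] sub1; rewrite /= => /andP[_].
    by move=> /eqP<-; apply: (dy d _).2; apply: sub1; exact: mem_head.
  rewrite -cats1 => /walk_cat[r _ /=/andP[_ /eqP<-]].
  by apply: (dy d' _).2; apply: sub1; rewrite inE mem_rcons mem_head orbT.
have [/existsP[b /andP[bu bv]]|nov] := boolP [exists b, (b != u) && star_step y b v].
  case: no_wheel'; last by exists b.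
  by apply/set0Pn; exists v; rewrite !inE eq_sym nuv.
have /existsP[k2 vyk2] := vN.
(* Two vertices and two colours are lost at a cost of one edge. Stars with two leaves in the
   triangle are excluded by [guv], [nou] and [nov]. *)
pose X := [set u; v; y]; pose K := [set k; k2].
have cX : #|X| = 3.
  by rewrite /X setUC cardsU1 !inE negb_or ![y == _]eq_sym nuy vy cards2 nuv.
have XP x : x \in X -> [\/ x = u, x = v | x = y].
  by rewrite !inE -orbA => /or3P[]/eqP; constructor.
have conn p q : p \in X -> q \in X -> p != q ->
     exists t, [/\ walk e p t q, uniq (map (@col C) t), size t <= 1 &
                   forall d, d \in t -> col d \in K].
  have go i a b : i \in K -> adj e i a b -> exists t,
      [/\ walk e a t b, uniq (map (@col C) t), size t <= 1 & forall d, d \in t -> col d \in K].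
    move=> iK /adj_walk[d di wd]; exists [:: d]; split=> // x; rewrite mem_seq1 => /eqP->.
    by rewrite di.
  have [kK k2K] : k \in K /\ k2 \in K by rewrite set21 set22.
  have [vu yu yv] : [/\ adj e k v u, adj e k y u & adj e k2 y v] by split; rewrite adj_sym.
  by move=> /XP[]-> /XP[]->; rewrite ?eqxx // => _;
    first [exact: go kK _ | exact: go k2K _].
have : h < uphalf (#|V|.+1 - #|X|) + 1.
  apply: (@contraction X u K); rewrite ?cX //.
  - by rewrite !inE eqxx.
  - by rewrite cards2; case: (_ != _).
  - move=> j a b jK /XP aX /XP bX; apply/negP=> ab.
    move: jK; rewrite !inE negb_or => /andP[jk jk2].
    have := nl _ _ _ ab; move: ab.
    case: aX bX => -> [] ->; rewrite ?eqxx // => ab _.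
    + by rewrite (adj_inj h2 uv ab) eqxx in jk.
    + by rewrite (adj_inj h2 uy ab) eqxx in jk.
    + by rewrite adj_sym in ab; rewrite (adj_inj h2 uv ab) eqxx in jk.
    + by rewrite (adj_inj h2 vyk2 ab) eqxx in jk2.
    + by rewrite adj_sym in ab; rewrite (adj_inj h2 uy ab) eqxx in jk.
    by rewrite adj_sym in ab; rewrite (adj_inj h2 vyk2 ab) eqxx in jk2.
  move=> j w a b _ wX /XP aX /XP bX nab wa wb.
  have wu : w != u by apply: contraNneq wX => ->; rewrite !inE eqxx.
  have Huv : adj e j w u -> adj e j w v -> False.
    by move=> *; case/negP: guv; apply: leaf_pairI; eassumption.
  have Huy : adj e j w u -> adj e j w y -> False.
    move=> p1 p2; case/negP: nou; apply/existsP; exists w; rewrite /star_step nuy andbT.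
    by apply/existsP; exists j; rewrite p1 p2.
  have Hvy : adj e j w v -> adj e j w y -> False.
    move=> p1 p2; case/negP: nov; apply/existsP; exists w; rewrite wu /star_step vy andbT.
    by apply/existsP; exists j; rewrite p1 p2.
  by move: nab wa wb; case: aX bX => -> [] ->; rewrite ?eqxx //; auto.
by rewrite cX Vh; move: h3; clear; lia.
Qed.

(** * Even order: absence of stars and the final contradiction *)

Lemma no_star k u v y : adj e k u v -> adj e k u y -> v = y.
Proof.
move=> uv uy; apply/eqP; apply: contraT => vy.
pose star j := [exists w, exists a, exists b, [&& adj e j w a, adj e j w b & a != b]].
have starI j w a b : adj e j w a -> adj e j w b -> a != b -> star j.
  by move=> wa wb ab; apply/existsP; exists w; apply/existsP; exists a; apply/existsP;
    exists b; rewrite wa wb.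
(* Both edges of a star are leaf pairs of stars, so the star colours form a family as in
   [leaf_pair_family]. *)
have : [set j | star j] = set0.
  apply: leaf_pair_family h2 _ => j b; rewrite inE => /existsP[w /existsP[a /existsP[a']]].
  case/and3P=> wa wa' aa'; have jb := adj_edge e j b.
  have : leaf_pair (e j b).1 (e j b).2.
    have [la la'] : leaf_pair w a /\ leaf_pair w a'.
      split; first exact: star_edges_leaf_pair wa wa' aa'.
      by apply: star_edges_leaf_pair wa' wa _; rewrite eq_sym.
    by have /orP[/parallelP|/parallelP] := adj_two wa wa' aa' jb; case=> -[-> ->] //;
      rewrite leaf_pairC.
  case/existsP=> i /existsP[x /andP[xa xb]]; exists i, x; split=> //.
  by rewrite inE; apply: starI xa xb _; apply: adj_irr jb.
by move/setP/(_ k); rewrite !inE (starI _ _ _ _ uv uy vy).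
Qed.

(** On average a vertex is the source of at least four triples, so some [u] has four. Without stars
    the edges at [u] have distinct colours. Contracting [u] with all its neighbours costs at most
    two and lowers half the order by at least two. *)
Lemma even_counterexample : False.
Proof.
have nl j a b : adj e j a b -> a != b by apply: adj_irr.
pose star u := [set d : C * bool * bool | src e d == u].
have [/existsP[u u4]|small] := boolP [exists u, 3 < #|star u|]; last first.
  have : #|{: C * bool * bool}| <= \sum_(u : V) 3.
    rewrite -sum1_card (partition_big (src e) xpredT) //=.
    apply: leq_sum => u _; rewrite sum1dep_card leqNgt; apply: contra small => u4.
    by apply/existsP; exists u.
  rewrite sum_nat_const !card_prod card_bool.
  by move: VC; rewrite Vh; move: h3; clear; lia.
have inj_col : {in star u &, injective (@col C)}.
  move=> d d'; rewrite !inE => /eqP su /eqP su' E.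
  have ad := adj_dart e d; have ad' := adj_dart e d'; rewrite su in ad.
  rewrite su' -E in ad'; have Et := no_star ad ad'; have ut := nl _ _ _ ad.
  move: E su su' Et ut {ad ad'}; case: d d' => [[k b] r] [[k' b'] r'];
    rewrite /col /= => <-.
  rewrite /src /tgt /=; have [<-|bb'] := eqVneq b b'.
    have [-> //|rr'] := eqVneq r r'.
    by case: r r' rr' => [] [] //= _ <- E; rewrite E eqxx.
  move=> su su' Et _; case/negP: (proper k).
  move: su su' Et; case: b b' bb' => [] [] // _;
    case: (e k true) (e k false) => a c [a' c']; case: r; case: r' => /= <- -> ->;
    apply/parallelP; auto.
pose X := u |: [set tgt e d | d in star u]; pose K := [set col d | d in star u].
have aK d : d \in star u -> adj e (col d) u (tgt e d).
  by rewrite inE => /eqP<-; apply: adj_dart.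
have colK d : d \in star u -> col d \in K by apply: imset_f.
have inj_tgt : {in star u &, injective (tgt e)}.
  move=> d d' du d'u E; apply: inj_col => //.
  by have := aK _ d'u; rewrite -E => /(adj_inj h2 (aK _ du)).
have uX' : u \notin [set tgt e d | d in star u].
  by apply/imsetP=> -[d /aK ad E]; have := nl _ _ _ ad; rewrite -E eqxx.
have cX : #|X| = #|star u|.+1 by rewrite cardsU1 uX' card_in_imset.
have cK : #|K| = #|star u| by rewrite card_in_imset.
have uK k x : adj e k u x -> k \in K.
  by case/adj_walk=> d <- /=/andP[/eqP sd _]; apply: colK; rewrite inE sd.
have XP x : x \in X -> x = u \/ exists2 d, d \in star u & x = tgt e d.
  by case/setU1P=> [->|/imsetP[d du ->]]; [left | right; exists d].
have : h < uphalf (#|V|.+1 - #|X|) + 2.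
  apply: (@contraction X u K); rewrite ?cX ?cK ?setU11 //.
  - by move: u4; clear; lia.
  - move=> k a b kK /XP[->|[d du ->]] /XP[->|[d' d'u ->]]; apply/negP=> ab.
    + by have := nl _ _ _ ab; rewrite eqxx.
    + by rewrite (uK _ _ ab) in kK.
    + by rewrite adj_sym in ab; rewrite (uK _ _ ab) in kK.
    apply: (@no_triangle (col d) k (col d') u (tgt e d) (tgt e d') h3) => //.
    + by apply: contraNneq kK => <-; apply: colK.
    + by apply: contraNneq kK => ->; apply: colK.
    + by apply: contraNneq (nl _ _ _ ab) => /inj_col->.
    + exact: aK.
    by rewrite adj_sym aK.
  - by move=> k w a b _ _ _ _ ab wa wb; rewrite (no_star wa wb) eqxx in ab.
  have out d : d \in star u -> exists2 d', col d' = col d & walk e u [:: d'] (tgt e d).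
    by move/aK/adj_walk.
  have into d : d \in star u -> exists2 d', col d' = col d & walk e (tgt e d) [:: d'] u.
    by move/aK; rewrite adj_sym => /adj_walk.
  move=> p q /XP[->|[d du ->]] /XP[->|[d' d'u ->]]; rewrite ?eqxx // => pq.
  - have [x xd' wx] := out _ d'u.
    by exists [:: x]; split=> // z; rewrite mem_seq1 => /eqP->; rewrite xd' colK.
  - have [x xd wx] := into _ du.
    by exists [:: x]; split=> // z; rewrite mem_seq1 => /eqP->; rewrite xd colK.
  have [x' xd' wx'] := out _ d'u; have [x xd wx] := into _ du.
  exists ([:: x] ++ [:: x']); split=> //.
  - by apply/walk_cat; exists u.
  - rewrite /= mem_seq1 xd xd' andbT; apply: contraNneq pq => E.
    by rewrite (inj_col _ _ du d'u E).
  by move=> z; rewrite !inE => /orP[]/eqP->; rewrite ?xd ?xd' colK.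
by rewrite cX Vh; move: u4 h3; clear; lia.
Qed.
End Counterexample.

(** * Completion of the induction *)

Lemma uniq_map_inj (T1 T2 : eqType) (f : T1 -> T2) (s : seq T1) :
  uniq (map f s) -> {in s &, injective f}.
Proof.
elim: s => // a s IH /=/andP[fas us] x y; rewrite !inE.
case/predU1P=> [->|xs] /predU1P[->|ys] E //; last exact: IH.
  by rewrite E map_f in fas.
by rewrite -E map_f in fas.
Qed.

(** Only finitely many tuples have length at most [h], so the case distinction is constructive. *)
Lemma rainbow_closed_dec (V C : finType) (e : C -> bool -> V * V) (h : nat) :
  (exists2 s, rainbow_closed e s & size s <= h) \/
  (forall s, rainbow_closed e s -> h < size s).
Proof.
pose P (s : seq (C * bool * bool)) :=
  [&& s != [::], uniq (map (@col C) s) & [exists p, walk e p s p]].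
have PP s : reflect (rainbow_closed e s) (P s).
  by apply: (iffP and3P) => -[s0 us /existsP].
have [/existsP[m /existsP[t /PP ct]]|no] :=
    boolP [exists m : 'I_h.+1, [exists t : m.-tuple (C * bool * bool), P t]].
  by left; exists (val t); rewrite // size_tuple -ltnS.
right=> s cs; rewrite ltnNge; apply: contra no => sh.
apply/existsP; exists (Ordinal (sh : size s < h.+1)); apply/existsP; exists (in_tuple s).
exact/PP.
Qed.

(** Without loops and parallel edges there are at least eight edges on only six pairs of
    vertices. *)
Lemma four_vertices (V C : finType) (e : C -> bool -> V * V) :
  #|V| = 4 -> 4 <= #|C| -> (forall k, ~~ parallel (e k true) (e k false)) ->
  (forall s, rainbow_closed e s -> 2 < size s) -> False.
Proof.
move=> cV cC proper long.
pose F (p : C * bool) := [set (e p.1 p.2).1; (e p.1 p.2).2].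
have injF : injective F.
  move=> [k b] [k' b'] /setP EF.
  apply: (parallel_edge_eq proper long isT).
  have n1 := adj_irr long (isT : 0 < 2) (adj_edge e k' b').
  have := EF (e k' b').2; have := EF (e k' b').1; rewrite !inE !eqxx orbT /=.
  move: n1; case: (e k b) (e k' b') => x y [x' y'] /= n1.
  move=> /pred2P[]E1 /pred2P[]E2; move: n1; rewrite E1 E2 ?eqxx // => _;
    apply/parallelP; auto.
have sub : F @: [set: C * bool] \subset [set A : {set V} | #|A| == 2].
  apply/subsetP=> A /imsetP[[k b] _ ->]; rewrite inE cards2 /=.
  by rewrite (adj_irr long (isT : 0 < 2) (adj_edge e k b)).
have := subset_leq_card sub; rewrite card_imset // cardsT card_prod card_bool card_draws cV.
by rewrite (_ : 'C(4, 2) = 6) // => c6; move: cC c6; clear; lia.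
Qed.

Lemma short_rainbow_closed_all n : short_rainbow_closed n.
Proof.
elim/ltn_ind: n => n IHn V C e cV /andP[n0 nC] proper.
have [k0 _] : exists k, k \in [set: C].
  by apply/card_gt0P; rewrite cardsT (leq_trans n0).
(* For [n <= 3] the strict bound [n - 1] is at most [uphalf n]. *)
have [n3|n4] := leqP n 3.
  have [||s [cs ss _]] := @pigeonhole_rainbow_closed_proper V C e setT setT k0 _ _ (in_setT _) (proper k0).
  - by rewrite !cardsT cV.
  - by move=> k b _; rewrite !inE.
  by exists s => //; rewrite cardsT cV in ss; move: ss n3; clear; lia.
have [//|long] := rainbow_closed_dec e (uphalf n).
have VC : #|V| <= #|C| by rewrite cV.
have IH m : m < #|V| -> short_rainbow_closed m by rewrite cV; apply: IHn.
have [on|en] := boolP (odd n).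
  have h2 : 1 < uphalf n by move: n4; clear; lia.
  have : [set: C] = set0.
    apply: (leaf_pair_family proper long h2) => k b _.
    have hV : uphalf #|V|.-1 < uphalf n by rewrite cV; move: on n4; clear; lia.
    have := edge_leaf_pair proper long VC IH h2 hV (adj_edge e k b).
    by case/existsP=> j /existsP[w /andP[p q]]; exists j, w; rewrite inE.
  by move/setP/(_ k0); rewrite !inE.
have [n6|n6] := ltnP 5 n.
  case: (even_counterexample proper long VC IH); first by move: n6; clear; lia.
  by rewrite cV; move: en; clear; lia.
have n4' : n = 4 by move: n4 n6 en; clear; lia.
by case: (@four_vertices V C e); rewrite -?n4' //; move: long; rewrite n4'.
Qed.

(** * From closed walks to cycles in simple graphs *)

(* [uphalf n] is the ceiling of n / 2. *)
Theorem theorem1p5 (n : nat) (T : finType) (e : rel T)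
    (C : finType) (c : {set T} -> C) :
  0 < n ->
  simple_graph e ->
  #|T| = n ->
  #|C| = n ->
  (forall k : C, 2 <= #|colour_class e c k|) ->
  exists p : seq T,
    [/\ graph_cycle e p, size p <= uphalf n & rainbow c (cycle_edges p)].
Proof.
move=> n0 [esym eirr] cT cC class2.
have H (k : C) : exists g : bool -> T * T,
    (forall b, e (g b).1 (g b).2 && (c [set (g b).1; (g b).2] == k)) /\
    ~~ parallel (g true) (g false).
  have /card_gt1P[A [B [Ak Bk nAB]]] := class2 k.
  have edge F : F \in colour_class e c k -> exists q : T * T, [/\ e q.1 q.2, c F = k & F = [set q.1; q.2]].
    by rewrite inE => /andP[/imsetP[q]]; rewrite inE => eq -> /eqP; exists q.
  have [q [eq cq Eq]] := edge A Ak; have [r [er cr Er]] := edge B Bk.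
  exists (fun b => if b then q else r); split.
    by case=> /=; rewrite -?Eq -?Er ?cq ?cr ?eq ?er eqxx.
  apply: contra nAB; rewrite Eq Er; case: q r {eq cq Eq er cr Er} => x y [x' y'] /=.
  by case/parallelP=> -[-> ->] //; rewrite setUC.
have [g Hg] := fin_all_exists H.
have [|k|s /rainbow_closed_uniq_src[t [[t0 ut [p w]] st _ us]] ss] :=
    @short_rainbow_closed_all n T C g cT.
- by rewrite n0 cC leqnn.
- by have [] := Hg k.
have edge d : e (src g d) (tgt g d) && (c [set src g d; tgt g d] == col d).
  case: d => -[k b] r; have [/(_ b)/andP[ekb ckb] _] := Hg k; rewrite /src /tgt /col /=.
  by case: r; rewrite ?ekb ?ckb // esym ekb setUC ckb.
(* The relation records that the step is an edge of [t], so that colours can be read off later. *)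
have cyc : cycle (fun x y => has (fun d => (src g d == x) && (tgt g d == y)) t) (map (src g) t).
  have pathP x s' q : {subset s' <= t} -> walk g x s' q -> s' != [::] ->
      path (fun x y => has (fun d => (src g d == x) && (tgt g d == y)) t) x
        (rcons (behead (map (src g) s')) q).
    elim: s' x => // d [|d' s'] IHs x sub /=.
      case/andP=> /eqP<- /eqP<- _; rewrite andbT; apply/hasP; exists d;
        last by rewrite !eqxx.
      by apply: sub; apply: mem_head.
    case/andP=> /eqP<- wd _; apply/andP; split.
      apply/hasP; exists d; first by apply: sub; apply: mem_head.
      by case/andP: wd => /eqP->; rewrite !eqxx.
    have Ed : tgt g d = src g d' by case/andP: wd => /eqP.
    rewrite -Ed; apply: IHs => //.
    by move=> a as'; apply: sub; rewrite inE as' orbT.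
  case: t t0 {ut st us} w pathP => // d t _ w pathP.
  have Ep : p = src g d by case/andP: w => /eqP->.
  by have := pathP p (d :: t) p (fun a => id) w isT; rewrite /= Ep.
exists (map (src g) t); split; last 1 first.
- have next x : x \in map (src g) t ->
      exists2 d, d \in t & [set x; next (map (src g) t) x] = [set src g d; tgt g d].
    by move/(next_cycle cyc)/hasP=> [d dt /andP[/eqP<- /eqP<-]]; exists d.
  move=> F F' /imsetP[x xt ->] /imsetP[x' x't ->].
  have [d dt ->] := next x xt; have [d' d't ->] := next x' x't.
  have /andP[_ /eqP->] := edge d; have /andP[_ /eqP->] := edge d' => E.
  by have -> : d = d' by apply: (uniq_map_inj ut).
- split.
  + rewrite /ucycle us andbT; apply: sub_cycle cyc => x y /hasP[d _ /andP[/eqP<- /eqP<-]].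
    by have /andP[] := edge d.
  (* One vertex would mean a loop; two vertices would give the same pair two colours. *)
  rewrite size_map; case: t t0 ut w {st us cyc} => // d [|d' [|//]] _ ut.
    by move=> /=/andP[/eqP<- /eqP E]; have /andP[] := edge d; rewrite E eirr.
  move=> /=/and3P[/eqP Es /eqP Em /eqP Et].
  have /andP[_ /eqP cd] := edge d; have /andP[_ /eqP cd'] := edge d'.
  by move: ut; rewrite /= mem_seq1 -cd -cd' Em Et Es setUC eqxx.
by rewrite size_map; apply: leq_trans ss.
Qed.
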